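(* For convex sets $C,D\subseteq\mathbb{R}^n$, $$T(C,D)=\operatorname{Span}\big(F_C(C\cap D)-F_D(C\cap D)\big),$$ where $T(C,D)$ is the joint supporting subspace of $C$ and $D$.
   Context: For sets $A,B\subseteq\mathbb{R}^n$, $A-B:=\{a-b\mid a\in A,\ b\in B\}$; $\operatorname{Span}$ denotes the linear span. Faces: for $C\subseteq\mathbb{R}^n$ convex, a subset $F\subseteq C$ is a face of $C$ if for all $y,z\in C$, whenever some point of $]y,z[\,:=\operatorname{conv}\{y,z\}\setminus\{y,z\}$ lies in $F$, both $y,z\in F$. For any set $S\subseteq C$, $F_C(S)$ denotes the face of $C$ generated by $S$, that is, the smallest face of $C$ that contains $S$ (equivalently, the intersection of all faces of $C$ containing $S$); for a point $x$, $F_C(x):=F_C(\{x\})$. The joint supporting subspace of two convex sets $C,D\subseteq\mathbb{R}^n$ is $T(C,D):=\operatorname{Span}F_{C-D}(0)$. *)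

(* Defs.v *)
From HB Require Import structures.
From mathcomp Require Import all_boot all_order all_algebra.
From mathcomp Require Import all_classical all_reals.
From mathcomp Require Import convex.

Set Implicit Arguments.
Unset Strict Implicit.
Unset Printing Implicit Defensive.

Import Order.TTheory GRing.Theory Num.Theory.

Local Open Scope classical_set_scope.
Local Open Scope ring_scope.

Definition set_sub (V : zmodType) (A B : set V) : set V :=
  [set a - b | a in A & b in B].

(* Finite linear combinations of elements of A; <<s>>%VS is the span of a
   finite sequence, and the span of set0 is [set 0]. *)
Definition lin_span (R : realType) (E : vectType R) (A : set E) : set E :=
  [set x | exists2 s : seq E, (forall a, a \in s -> A a) & x \in <<s>>%VS].

Definition conv_hull (R : realType) (E : lmodType R) (A : set E) : set E :=
  smallest (@convex_set R E) A.

Definition open_segment (R : realType) (E : lmodType R) (y z : E) : set E :=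
  conv_hull [set y; z] `\` [set y; z].

(* Faces are not required to be convex, and set0 is a face. *)
Definition is_face (R : realType) (E : lmodType R) (C F : set E) : Prop :=
  F `<=` C /\
  forall y z, C y -> C z -> open_segment y z `&` F !=set0 -> F y /\ F z.

(* When S is not included in C, no face of C contains S; the guard gives
   face_gen C S = set0 then, where the bare intersection of the empty family
   of faces would be the whole space. *)
Definition face_gen (R : realType) (E : lmodType R) (C S : set E) : set E :=
  [set x | S `<=` C /\ smallest (is_face C) S x].

Definition joint_supporting_subspace (R : realType) (E : vectType R)
    (C D : set E) : set E :=
  lin_span (face_gen (set_sub C D) [set 0]).

(* Main.v *)
Require Import Defs.
From HB Require Import structures.
From mathcomp Require Import all_boot all_order all_algebra.
From mathcomp Require Import all_classical all_reals.
From mathcomp Require Import convex.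
From mathcomp Require Import interval_inference lra.

(** The two spans agree because the spanned sets already do:
    F_(C-D)(0) = F_C(C `&` D) - F_D(C `&` D) (lemma [face_gen_set_sub]).

    In a convex set C, a point y lies in the face generated by x exactly when
    the segment from y to x can be prolonged beyond x inside C, that is, when
    x = l y + (1 - l) z with z in C and 0 < l < 1 ([face_of_pt]).  As faces need
    not be convex, a union of faces is a face, so F_C(S) is the union of the
    F_C(x) for x in S ([face_genE]).

    If c - d lies in F_(C-D)(0), then 0 = l (c - d) + (1 - l) (c' - d'), which
    says that l c + (1 - l) c' = l d + (1 - l) d'.  This common point x is in
    C `&` D, and by construction c is in F_C(x) and d in F_D(x).  Conversely, let
    c be in F_C(x) and d in F_D(y) with x, y in C `&` D.  Then c and d are in the
    faces generated by the midpoint m of x and y ([face_of_pt_mid]), and the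
    weights of c and d in the decompositions of m can be lowered to a common
    value ([face_weight_le]); subtracting the two decompositions exhibits 0 as a
    point of an open segment issued from c - d. *)

Set Implicit Arguments.
Unset Strict Implicit.
Unset Printing Implicit Defensive.

Import Order.TTheory GRing.Theory Num.Theory.

Local Open Scope classical_set_scope.
Local Open Scope ring_scope.

Lemma convex_setP (R : realType) (E : lmodType R) (C : set E) :
  convex_set C <->
  forall x y (l : R), C x -> C y -> 0 <= l <= 1 -> C (l *: x + (1 - l) *: y).
Proof.
split=> [hC x y l Cx Cy /andP[l0 l1]|hC x y l].
  pose t := Itv01 l0 l1.
  by have := hC x y t (mem_set Cx) (mem_set Cy); rewrite inE.
rewrite !inE => Cx Cy; apply: hC => //.
by rewrite ge0 le1.
Qed.

(** The homogeneous form of convexity spares the divisions when several points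
    of a convex combination are to be merged into one. *)
Lemma convex_merge (R : realType) (E : lmodType R) (C : set E) (x y : E)
    (a b : R) : convex_set C -> C x -> C y -> 0 <= a -> 0 <= b -> 0 < a + b ->
  exists2 z, C z & a *: x + b *: y = (a + b) *: z.
Proof.
move=> /convex_setP hC Cx Cy a0 b0 ab0.
have ab_neq0 : a + b != 0 by rewrite gt_eqF.
exists (a / (a + b) *: x + (1 - a / (a + b)) *: y).
  apply: hC => //; rewrite divr_ge0 ?(ltW ab0)//=.
  by rewrite ler_pdivrMr// mul1r lerDl.
rewrite scalerDr !scalerA mulrBr mulr1 mulrC divfK//.
by rewrite (addrC a b) addrK.
Qed.

Lemma set_sub_convex (R : realType) (E : lmodType R) (C D : set E) :
  convex_set C -> convex_set D -> convex_set (set_sub C D).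
Proof.
move=> /convex_setP hC /convex_setP hD; apply/convex_setP.
move=> _ _ l [c Cc [d Dd <-]] [c' Cc' [d' Dd' <-]] l01.
exists (l *: c + (1 - l) *: c'); first exact: hC.
exists (l *: d + (1 - l) *: d'); first exact: hD.
by rewrite !scalerBr opprD addrACA.
Qed.

Lemma open_segmentP (R : realType) (E : lmodType R) (y z w : E) :
  open_segment y z w ->
  exists2 l : R, 0 < l < 1 & w = l *: y + (1 - l) *: z.
Proof.
move=> [hw wyz].
pose S : set E :=
  [set w | exists2 l : R, 0 <= l <= 1 & w = l *: y + (1 - l) *: z].
have cS : convex_set S.
  apply/convex_setP => _ _ t [a /andP[a0 a1] ->] [b /andP[b0 b1] ->].
  move=> /andP[t0 t1]; exists (t * a + (1 - t) * b); first by apply/andP; nra.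
  rewrite !scalerDr !scalerA addrACA -!scalerDl.
  by congr (_ + _ *: _); lra.
have SY : [set y; z] `<=` S.
  move=> _ [->|->]; [exists 1|exists 0]; rewrite ?lexx ?ler01//.
    by rewrite subrr scale0r scale1r addr0.
  by rewrite subr0 scale0r scale1r add0r.
have [l /andP[l0 l1] wE] := smallest_sub cS SY hw.
exists l => //; rewrite !lt_neqAle l0 l1 !andbT; apply/andP; split.
  apply/eqP => l_eq; apply: wyz; right.
  by rewrite wE /= -l_eq subr0 scale0r scale1r add0r.
apply/eqP => l_eq; apply: wyz; left.
by rewrite wE /= l_eq subrr scale0r scale1r addr0.
Qed.

Lemma open_segment_comb (R : realType) (E : lmodType R) (y z : E) (l : R) :
  0 < l < 1 -> y <> z -> open_segment y z (l *: y + (1 - l) *: z).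
Proof.
move=> /andP[l0 l1] yz; split.
  move=> S [/convex_setP cS YS]; apply: cS; first by apply: YS; left.
    by apply: YS; right.
  by rewrite !ltW.
have yz0 : y - z != 0 by rewrite subr_eq0; apply/eqP.
have E0 : l *: y + (1 - l) *: z = l *: (y - z) + z.
  by rewrite scalerBl scale1r scalerBr -addrA (addrC (- _)).
have E1 : l *: y + (1 - l) *: z = (l - 1) *: (y - z) + y.
  by rewrite E0 scalerBl scale1r opprB -!addrA addNr addr0.
case=> /eqP.
  by rewrite E1 -subr_eq0 addrK scaler_eq0 subr_eq0 (negPf yz0) lt_eqF.
by rewrite E0 -subr_eq0 addrK scaler_eq0 (negPf yz0) gt_eqF.
Qed.

(** An explicit form of F_C(x), for C convex and x in C.  The open segment that
    carries x may be degenerate, so that x itself qualifies, with y = z = x. *)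
Definition face_of_pt (R : realType) (E : lmodType R) (C : set E) (x : E) :
    set E :=
  [set y | C y /\ exists2 z, C z &
    exists2 l : R, 0 < l < 1 & x = l *: y + (1 - l) *: z].

Lemma face_of_pt_refl (R : realType) (E : lmodType R) (C : set E) (x : E) :
  C x -> face_of_pt C x x.
Proof.
move=> Cx; split=> //; exists x => //; exists 2^-1; first by apply/andP; lra.
by rewrite -scalerDl addrC subrK scale1r.
Qed.

(** If w is inside ]y,z[ and x is inside ]w,v[, then x is a combination of y, z
    and v with a positive weight on y; merging z with v prolongs [y,x]. *)
Lemma face_of_pt_segment (R : realType) (E : lmodType R) (C : set E)
    (x y z w : E) (l : R) : convex_set C -> C y -> C z -> 0 < l < 1 ->
  w = l *: y + (1 - l) *: z -> face_of_pt C x w -> face_of_pt C x y.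
Proof.
move=> hC Cy Cz /andP[l0 l1] wE [_ [v Cv [k /andP[k0 k1] xE]]]; split=> //.
have [| | |u Cu uE] := @convex_merge _ _ _ z v (k * (1 - l)) (1 - k) hC Cz Cv.
- by nra.
- by nra.
- by nra.
exists u => //; exists (k * l); first by apply/andP; nra.
rewrite xE wE scalerDr !scalerA -addrA uE.
by congr (_ + _ *: _); lra.
Qed.

Lemma face_of_pt_face (R : realType) (E : lmodType R) (C : set E) (x : E) :
  convex_set C -> is_face C (face_of_pt C x).
Proof.
move=> hC; split=> [y []//|y z Cy Cz [w [/open_segmentP[l l01 wE] xw]]].
split; first exact: (@face_of_pt_segment _ _ _ _ _ z w l).
apply: (@face_of_pt_segment _ _ _ _ _ y w (1 - l)) => //.
  by move/andP: l01 => [? ?]; apply/andP; lra.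
by rewrite opprB addrCA subrr addr0 addrC.
Qed.

Lemma face_of_pt_sub_face (R : realType) (E : lmodType R) (C F : set E)
    (x : E) : is_face C F -> F x -> face_of_pt C x `<=` F.
Proof.
move=> [_ hF] Fx y [Cy [z Cz [l l01 xE]]].
have [yz|yz] := pselect (y = z).
  by move: xE; rewrite -yz -scalerDl addrC subrK scale1r => <-.
have [] // := hF y z Cy Cz.
by exists x; split=> //; rewrite xE; exact: open_segment_comb.
Qed.

(** The union on the right is a face because no convexity is required of faces:
    a segment that meets it meets one of its members. *)
Lemma face_genE (R : realType) (E : lmodType R) (C S : set E) :
  convex_set C -> S `<=` C ->
  face_gen C S = \bigcup_(x in S) face_of_pt C x.
Proof.
move=> hC SC; apply/seteqP; split=> [y [_]|y [x Sx xy]].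
  apply: smallest_sub; last by move=> x Sx; exists x => //; exact/face_of_pt_refl/SC.
  split=> [z [x _ []]//|u v Cu Cv [w [uvw [x Sx xw]]]].
  have [] := (face_of_pt_face x hC).2 u v Cu Cv; first by exists w.
  by split; exists x.
split=> // F [hF SF]; exact: (face_of_pt_sub_face hF (SF _ Sx)).
Qed.

(** The other endpoint is pulled towards y. *)
Lemma face_weight_le (R : realType) (E : lmodType R) (C : set E) (x y z : E)
    (k l : R) : convex_set C -> C y -> C z -> l < 1 -> k <= l ->
  x = l *: y + (1 - l) *: z ->
  exists2 z', C z' & x = k *: y + (1 - k) *: z'.
Proof.
move=> hC Cy Cz l1 kl xE.
have [| | |u Cu uE] := @convex_merge _ _ _ y z (l - k) (1 - l) hC Cy Cz.
- by lra.
- by lra.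
- by lra.
have lE : l *: y = k *: y + (l - k) *: y by rewrite -scalerDl addrC subrK.
exists u => //; rewrite xE lE -addrA uE.
by congr (_ + _ *: _); lra.
Qed.

(** The face generated by the midpoint contains x, since the midpoint is inside
    ]x,x'[ when x and x' differ; it therefore contains the face generated by x. *)
Lemma face_of_pt_mid (R : realType) (E : lmodType R) (C : set E) (x x' : E) :
  convex_set C -> C x -> C x' ->
  face_of_pt C x `<=` face_of_pt C (2^-1 *: x + (1 - 2^-1) *: x').
Proof.
move=> hC Cx Cx'; apply: face_of_pt_sub_face; first exact: face_of_pt_face.
by split=> //; exists x' => //; exists 2^-1 => //; apply/andP; lra.
Qed.

Lemma face_gen_set_sub (R : realType) (E : lmodType R) (C D : set E) :
  convex_set C -> convex_set D ->
  face_gen (set_sub C D) [set 0] =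
  set_sub (face_gen C (C `&` D)) (face_gen D (C `&` D)).
Proof.
move=> hC hD; have hCD := set_sub_convex hC hD.
rewrite (face_genE (C := C))// (face_genE (C := D))//.
apply/seteqP; split=> [w [CD0 wF]|].
  have : face_gen (set_sub C D) [set 0] w by [].
  rewrite face_genE// => -[_ ->] [[c Cc [d Dd <-]] [_ [c' Cc' [d' Dd' <-]]]].
  move=> [l l01 E0].
  have xE : l *: c + (1 - l) *: c' = l *: d + (1 - l) *: d'.
    by apply/eqP; rewrite -subr_eq0 E0 !scalerBr opprD addrACA.
  have l01' : 0 <= l <= 1 by move/andP: l01 => [? ?]; rewrite !ltW.
  have Cx : C (l *: c + (1 - l) *: c') by exact: (convex_setP _).1.
  have Dx : D (l *: c + (1 - l) *: c') by rewrite xE; exact: (convex_setP _).1.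
  exists c.
    by exists (l *: c + (1 - l) *: c') => //; split=> //; exists c' => //; exists l.
  exists d => //.
  by exists (l *: c + (1 - l) *: c') => //; split=> //; exists d' => //; exists l.
move=> _ [c [x [Cx Dx] xc] [d [y [Cy Dy] yd] <-]].
rewrite face_genE//; last by move=> _ ->; exists x => //; exists x => //; rewrite subrr.
exists 0 => //.
set m := 2^-1 *: x + (1 - 2^-1) *: y.
have mE : m = 2^-1 *: y + (1 - 2^-1) *: x.
  by rewrite /m addrC; congr (_ *: _ + _ *: _); lra.
have [Cc [c' Cc' [l /andP[l0 l1] mc]]] : face_of_pt C m c.
  exact: face_of_pt_mid xc.
have [Dd [d' Dd' [k /andP[k0 k1] md]]] : face_of_pt D m d.
  by rewrite mE; exact: face_of_pt_mid yd.
pose p := Num.min l k.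
have [c1 Cc1 mc1] : exists2 z, C z & m = p *: c + (1 - p) *: z.
  by apply: (@face_weight_le _ _ _ _ _ c' p l) => //; rewrite ge_min lexx.
have [d1 Dd1 md1] : exists2 z, D z & m = p *: d + (1 - p) *: z.
  by apply: (@face_weight_le _ _ _ _ _ d' p k) => //; rewrite ge_min lexx orbT.
split; first by exists c => //; exists d.
exists (c1 - d1); first by exists c1 => //; exists d1.
exists p; first by rewrite lt_min l0 k0 gt_min l1.
by rewrite !scalerBr addrACA -opprD -mc1 -md1 subrr.
Qed.

Theorem corollary4p3 (R : realType) (n : nat) (C D : set 'rV[R]_n)
    (hC : convex_set C) (hD : convex_set D) :
  joint_supporting_subspace C D =
  lin_span (set_sub (face_gen C (C `&` D)) (face_gen D (C `&` D))).
Proof. by rewrite /joint_supporting_subspace face_gen_set_sub. Qed.
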